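(* Let $\Gamma_1$ and $\Gamma_2$ be two finite simple graphs. Then \[\mathrm{pmd}(\Gamma_1\square\Gamma_2)\leq\min\{\mathrm{pmd}(\Gamma_1)\chi(\Gamma_2)+\mathrm{pmd}(\Gamma_2),\ \mathrm{pmd}(\Gamma_2)\chi(\Gamma_1)+\mathrm{pmd}(\Gamma_1)\}.\]
   Context: All graphs are finite and simple. A set $M\subseteq E$ of edges of a graph $\Gamma=(V,E)$ is a matching if its edges are pairwise disjoint. A matching $M$ is positive (in $\Gamma$) if there is a weight function $w\colon V\to\mathbb{R}$ such that for every edge $uv\in E$: $w(u)+w(v)>0$ if and only if $uv\in M$. A positive matching decomposition (pmd) of $\Gamma$ with $p$ parts is an ordered partition $E_1,\ldots,E_p$ of $E$ such that $E_i$ is a positive matching of the graph $(V,E\setminus\bigcup_{j=1}^{i-1}E_j)$ for $i=1,\ldots,p$. $\mathrm{pmd}(\Gamma)$ denotes the smallest $p$ for which $\Gamma$ has a pmd with $p$ parts. The Cartesian product $\Gamma_1\square\Gamma_2$ has vertex set $V(\Gamma_1)\times V(\Gamma_2)$, with $(a_1,a_2)\sim(b_1,b_2)$ if either $a_1=b_1$ and $a_2\sim b_2$, or $a_1\sim b_1$ and $a_2=b_2$. $\chi(\Gamma)$ is the chromatic number of $\Gamma$. *)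

(* Defs.v *)
From mathcomp Require Import all_boot all_order all_algebra.
From mathcomp Require Import boolp reals.

Set Implicit Arguments.
Unset Strict Implicit.
Unset Printing Implicit Defensive.

Import Order.TTheory GRing.Theory Num.Theory.

Record sgraph := SGraph {
  vertex :> finType;
  adj : rel vertex;
  adj_sym : symmetric adj;
  adj_irr : irreflexive adj }.

(* Edges are unordered pairs of adjacent vertices, encoded as 2-element sets. *)
Definition edges (G : sgraph) : {set {set G}} :=
  [set [set p.1; p.2] | p : G * G & adj p.1 p.2].

Lemma in_edges (G : sgraph) (x y : G) : ([set x; y] \in edges G) = adj x y.
Proof.
apply/imsetP/idP => [[[a b]]|xy]; last by exists (x, y); rewrite ?inE.
rewrite inE /= => ab eqE.
have neq_ab : a != b by apply: contraTneq ab => ->; rewrite adj_irr.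
have /setP E := eqE.
have := E x; have := E y; rewrite !inE !eqxx orbT /=.
move=> /esym/orP[]/eqP ey /esym/orP[]/eqP ex; subst x y => //.
- by have := E b; rewrite !inE eqxx orbT !(eq_sym b) (negPf neq_ab).
- by rewrite adj_sym.
- by have := E a; rewrite !inE eqxx (negPf neq_ab).
Qed.

Definition del_edges_rel (G : sgraph) (F : {set {set G}}) : rel G :=
  fun x y => adj x y && ([set x; y] \notin F).

Lemma del_edges_sym (G : sgraph) (F : {set {set G}}) :
  symmetric (del_edges_rel F).
Proof. by move=> x y; rewrite /del_edges_rel adj_sym setUC. Qed.

Lemma del_edges_irr (G : sgraph) (F : {set {set G}}) :
  irreflexive (del_edges_rel F).
Proof. by move=> x; rewrite /del_edges_rel adj_irr. Qed.

(* The graph (V, E \ F). *)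
Definition del_edges (G : sgraph) (F : {set {set G}}) : sgraph :=
  SGraph (@del_edges_sym G F) (@del_edges_irr G F).

Definition cart_rel (G1 G2 : sgraph) : rel (G1 * G2) :=
  fun a b => ((a.1 == b.1) && adj a.2 b.2) || (adj a.1 b.1 && (a.2 == b.2)).

Lemma cart_sym (G1 G2 : sgraph) : symmetric (@cart_rel G1 G2).
Proof.
by move=> a b; rewrite /cart_rel (eq_sym a.1) (eq_sym a.2) adj_sym (adj_sym a.1).
Qed.

Lemma cart_irr (G1 G2 : sgraph) : irreflexive (@cart_rel G1 G2).
Proof. by move=> a; rewrite /cart_rel !adj_irr andbF. Qed.

Definition cart_prod (G1 G2 : sgraph) : sgraph :=
  SGraph (@cart_sym G1 G2) (@cart_irr G1 G2).

Definition matching (G : sgraph) (M : {set {set G}}) : bool :=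
  (M \subset edges G) && trivIset M.

Definition positive_matching (R : realType) (G : sgraph) (M : {set {set G}}) :
    Prop :=
  matching M /\
  exists w : G -> R,
    forall u v : G, adj u v -> (0 < w u + w v)%R <-> [set u; v] \in M.

(* [partition] requires the parts to be nonempty; injectivity of [E] makes the
   indexed parts pairwise distinct, hence pairwise disjoint. *)
Definition is_pmd (R : realType) (G : sgraph) (p : nat)
    (E : 'I_p -> {set {set G}}) : Prop :=
  [/\ injective E,
      partition [set E i | i : 'I_p] (edges G) &
      forall i : 'I_p,
        positive_matching R
          (G := del_edges (\bigcup_(j < p | j < i) E j)) (E i)].

Definition has_pmd (R : realType) (G : sgraph) (p : nat) : Prop :=
  exists E : 'I_p -> {set {set G}}, is_pmd R E.

(* Putting each edge in its own part gives a positive matching decomposition. *)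
Lemma has_pmd_card_edges (R : realType) (G : sgraph) :
  has_pmd R G #|edges G|.
Proof.
exists (fun i => [set enum_val i]); split.
- by move=> i j /set1_inj/enum_val_inj.
- have -> : [set [set enum_val i] | i : 'I_#|edges G|]
            = [set [set e] | e in edges G].
    apply/setP => A; apply/imsetP/imsetP => [[i _ ->]|[e eE ->]].
      by exists (enum_val i) => //; apply: enum_valP.
    by exists (enum_rank_in eE e) => //; rewrite enum_rankK_in.
  apply/and3P; split.
  + rewrite /cover big_imset /=; last by move=> ? ? _ _ /set1_inj.
    apply/eqP/setP => e; apply/bigcupP/idP => [[f fE]|eE].
      by rewrite inE => /eqP->.
    by exists e; rewrite ?inE.
  + apply/trivIsetP => _ _ /imsetP[e _ ->] /imsetP[f _ ->] nef.
    by rewrite disjoints1 inE; apply: contraNneq nef => ->.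
  + by apply/imsetP => -[e _ /setP/(_ e)]; rewrite !inE eqxx.
- move=> i; have := enum_valP i; case/imsetP => -[a b]; rewrite inE /= => ab ei.
  split.
    apply/andP; split; last by rewrite /trivIset /cover !big_set1.
    rewrite sub1set ei in_edges /= /del_edges_rel ab -ei /=.
    apply/bigcupP => -[j ji]; rewrite inE => /eqP/enum_val_inj ij.
    by rewrite ij ltnn in ji.
  exists (fun x => if x \in enum_val i then 1%R else (- 2%:R)%R) => u v.
  rewrite /= => /andP[uv _]; rewrite inE.
  have neq_uv : u != v by apply: contraTneq uv => ->; rewrite adj_irr.
  split; last by move=> /eqP <-; rewrite !inE !eqxx orbT addr_gt0.
  case: ifP => iu; case: ifP => iv.
  + move=> _; rewrite ei in iu iv *; move: iu iv neq_uv; rewrite !inE.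
    by move=> /orP[]/eqP-> /orP[]/eqP->; rewrite ?eqxx // setUC.
  + by rewrite subr_gt0 (ltr_nat _ 2 1).
  + by rewrite addrC subr_gt0 (ltr_nat _ 2 1).
  + by rewrite -opprD oppr_gt0 -natrD ltrn0.
Qed.

Lemma ex_pmd (R : realType) (G : sgraph) : exists p, `[< has_pmd R G p >].
Proof. by exists #|edges G|; apply/asboolP/has_pmd_card_edges. Qed.

Definition pmd (R : realType) (G : sgraph) : nat := ex_minn (ex_pmd R G).

Definition proper_coloring (G : sgraph) (k : nat) (c : {ffun G -> 'I_k}) :
    bool :=
  [forall x : G, forall y : G, adj x y ==> (c x != c y)].

Definition colorable (G : sgraph) (k : nat) : bool :=
  [exists c : {ffun G -> 'I_k}, proper_coloring c].

Lemma ex_colorable (G : sgraph) : exists k, colorable G k.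
Proof.
exists #|G|; apply/existsP; exists [ffun x => enum_rank x].
apply/forallP => x; apply/forallP => y; apply/implyP => xy; rewrite !ffunE.
by apply: contraTneq xy => /enum_rank_inj->; rewrite adj_irr.
Qed.

Definition chromatic_number (G : sgraph) : nat := ex_minn (ex_colorable G).

(* Main.v *)
Require Import Defs.
From mathcomp Require Import all_boot all_order all_algebra.
From mathcomp Require Import boolp reals.
From mathcomp Require Import zify.

(**
Let E_0, ..., E_(p-1) and F_0, ..., F_(q-1) be pmds of G1 and G2, and c a
proper k-colouring of G2. First remove, in lexicographic order of (i, j), the
copies of E_i lying over the colour class j: give (a, y) the weight w_i(a) if
c(y) = j and a very negative weight otherwise. Edges over other colour classes
get a nonpositive sum, and so do the edges (a, y)(a, y'), because y and y' have
different colours. What is left is a disjoint union of copies of G2, which is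
decomposed by the copies of the F_i.
*)

Set Implicit Arguments.
Unset Strict Implicit.
Unset Printing Implicit Defensive.

Import Order.TTheory GRing.Theory Num.Theory.

Lemma set2_eq (T : finType) (a b x y : T) :
  [set a; b] = [set x; y] -> (a = x /\ b = y) \/ (a = y /\ b = x).
Proof.
move=> /setP E; have := E y; have := E x; have := E b; have := E a.
rewrite !inE !eqxx !orbT /=.
move=> /esym/orP[]/eqP Ha /esym/orP[]/eqP Hb /orP[]/eqP Hx /orP[]/eqP Hy.
all: by subst; auto.
Qed.

(* A pmd in which empty parts are allowed, [l u v] being the index of the part
   of the edge [uv]; values of [l] at nonadjacent pairs are irrelevant. *)
Definition pmd_labelling (R : realType) (G : sgraph) (n : nat)
    (l : G -> G -> nat) : Prop :=
  [/\ forall u v, adj u v -> l u v = l v u,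
      forall u v, adj u v -> l u v < n,
      forall u v v', adj u v -> adj u v' -> l u v = l u v' -> v = v' &
      forall i, i < n -> exists w : G -> R,
        forall u v, adj u v -> i <= l u v ->
          (0 < w u + w v)%R <-> l u v = i].

(** The parts are disjoint and cover the edges, so each edge has a unique index. The edges with
    label at least [i] are those left at stage [i], hence the weights carry over. *)
Lemma has_pmd_labelling (R : realType) (G : sgraph) (n : nat) :
  has_pmd R G n -> exists l, @pmd_labelling R G n l.
Proof.
move=> [E [injE partE posE]].
have [/eqP covE trivE _] := and3P partE.
have exE u v : adj u v -> exists i, [set u; v] \in E i.
  rewrite -in_edges -covE => /bigcupP[_ /imsetP[i _ ->] uvi]; by exists i.
have uniqE e i j : e \in E i -> e \in E j -> i = j.
  move=> ei ej; apply/injE/eqP/negPn/negP => neq.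
  have /trivIsetP/(_ (E i) (E j)) := trivE; rewrite !imset_f // => /(_ isT isT neq).
  by move=> /pred0P/(_ e); rewrite /= ei ej.
(* The default [0] is reached only at nonadjacent pairs, by [exE]. *)
pose l (u v : G) : nat :=
  if [pick i | [set u; v] \in E i] is Some i then val i else 0.
have lE u v (i : 'I_n) : [set u; v] \in E i -> l u v = i.
  rewrite /l; case: pickP => [j uvj uvi|/(_ i)->//].
  by rewrite (uniqE _ _ _ uvj uvi).
exists l; split.
- by move=> u v _; rewrite /l setUC.
- by move=> u v /exE[i /lE ->].
- move=> u v v' uv uv'; have [i uvi] := exE _ _ uv; have [j uvj] := exE _ _ uv'.
  rewrite (lE _ _ _ uvi) (lE _ _ _ uvj) => /val_inj ij; subst j.
  have [/andP[_ /trivIsetP triv] _] := posE i.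
  have [eq_e|neq_e] := eqVneq [set u; v] [set u; v'].
    by case: (set2_eq eq_e) => [[]//|[-> ->]].
  have /pred0P/(_ u) := triv _ _ uvi uvj neq_e.
  by rewrite /= !inE eqxx.
- move=> i ltin; have [_ [w wP]] := posE (Ordinal ltin).
  exists w => u v uv ile; have [j uvj] := exE _ _ uv.
  have luv := lE _ _ _ uvj.
  rewrite wP /=; last first.
    rewrite /del_edges_rel uv; apply/bigcupP => -[k /= ki uvk].
    by move: ile; rewrite (lE _ _ _ uvk) leqNgt ki.
  split=> [/lE->//|luvi].
  suff <- : j = Ordinal ltin by [].
  by apply: val_inj; rewrite /= -luv.
Qed.

(** The parts are the label classes. Surjectivity makes them nonempty, which [partition] demands and
    which also makes the indexing injective. *)
Lemma surj_labelling_has_pmd (R : realType) (G : sgraph) (n : nat) l :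
  @pmd_labelling R G n l ->
  (forall i, i < n -> exists u v : G, adj u v /\ l u v = i) ->
  has_pmd R G n.
Proof.
move=> [lC ltl lM lW] lS.
pose E (i : 'I_n) : {set {set G}} :=
  [set [set p.1; p.2] | p : G * G & adj p.1 p.2 && (l p.1 p.2 == i)].
have memE u v i : ([set u; v] \in E i) = adj u v && (l u v == i).
  apply/imsetP/idP => [[[a b]]|uv]; last by exists (u, v); rewrite ?inE.
  rewrite inE /= => /andP[ab lab] /set2_eq[][-> ->]; first by rewrite ab.
  by rewrite adj_sym ab -lC.
have exE i e : e \in E i -> exists u v, [/\ e = [set u; v], adj u v & l u v = i].
  case/imsetP=> -[u v]; rewrite inE /= => /andP[uv /eqP luv] ->.
  by exists u, v.
have uniqE e i j : e \in E i -> e \in E j -> i = j.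
  move=> /exE[u [v [-> uv luv]]]; rewrite memE uv luv => /eqP.
  exact: val_inj.
have neE i : exists e, e \in E i.
  have [u [v [uv luv]]] := lS i (ltn_ord i).
  by exists [set u; v]; rewrite memE uv luv /=.
have trivE i : trivIset (E i).
  apply/trivIsetP => e f ei fi; apply: contraNT => /pred0Pn[x /=].
  (* Two edges of one class meeting at [x] are both written with [x] as first endpoint, so that [lM]
     identifies them. *)
  have endpoint g : g \in E i -> x \in g ->
      exists y, [/\ g = [set x; y], adj x y & l x y = i].
    move=> /exE[u [v [-> uv luv]]]; rewrite !inE => /orP[]/eqP->.
      by exists v.
    by exists u; rewrite setUC adj_sym -lC.
  move=> /andP[/(endpoint _ ei)[y [-> xy lxy]] /(endpoint _ fi)[z [-> xz lxz]]].
  by rewrite (lM x y z) // lxy.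
exists E; split.
- move=> i j eqE; have [e ei] := neE i; apply: (uniqE e) => //.
  by rewrite -eqE.
- apply/and3P; split.
  + apply/eqP/setP => e; apply/bigcupP/idP.
      by move=> [_ /imsetP[i _ ->] /exE[u [v [-> uv _]]]]; rewrite in_edges.
    case/imsetP=> -[u v]; rewrite inE /= => uv ->.
    exists (E (Ordinal (ltl _ _ uv))); first exact: imset_f.
    by rewrite memE uv /=.
  + apply/trivIsetP => _ _ /imsetP[i _ ->] /imsetP[j _ ->] neq.
    apply/pred0P => e /=; apply/negP => /andP[ei ej].
    by rewrite (uniqE _ _ _ ei ej) eqxx in neq.
  + apply/imsetP => -[i _ E0]; have [e] := neE i.
    by rewrite -E0 inE.
- move=> i; split.
    apply/andP; split.
      apply/subsetP => e ei; have [u [v [eE uv luv]]] := exE _ _ ei; subst e.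
      rewrite in_edges /= /del_edges_rel uv /=.
      apply/bigcupP => -[j ji]; move/(uniqE _ _ _ ei) => ij.
      by rewrite ij ltnn in ji.
    exact: trivE.
  have [w wP] := lW i (ltn_ord i).
  exists w => u v /= /andP[uv uvN].
  have ile : i <= l u v.
    rewrite leqNgt; apply: contraNN uvN => lti.
    apply/bigcupP; exists (Ordinal (ltl _ _ uv)) => //.
    by rewrite memE uv /=.
  rewrite wP // memE uv; split=> [->|/eqP//]; exact: eqxx.
Qed.

(** A label that no edge attains can be skipped by shifting the larger ones down, so induction on
    [n] reduces to the surjective case. *)
Lemma pmd_le_labelling (R : realType) (G : sgraph) (n : nat) l :
  @pmd_labelling R G n l -> pmd R G <= n.
Proof.
elim: n l => [|n IHn] l lP.
  rewrite /pmd; case: ex_minnP => m _; apply; apply/asboolP.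
  exact: surj_labelling_has_pmd lP _.
have [lS|] := pselect (forall i, i < n.+1 -> exists u v, adj u v /\ l u v = i).
  rewrite /pmd; case: ex_minnP => m _; apply; apply/asboolP.
  exact: surj_labelling_has_pmd lP lS.
move=> /existsNP[i /not_implyP[ltin unused]].
have lNi u v : adj u v -> l u v <> i by move=> uv luv; apply: unused; exists u, v.
case: lP => lC ltl lM lW.
apply: leqW; apply: (IHn (fun u v => unbump i (l u v))); split.
- by move=> u v /lC ->.
- move=> u v uv; have := ltl _ _ uv; have := lNi _ _ uv.
  by rewrite /unbump; lia.
- move=> u v v' uv uv' eql; apply: (lM u) => //.
  have := lNi _ _ uv; have := lNi _ _ uv'; move: eql.
  by rewrite /unbump; lia.
(* The new label [j] comes from the old label [bump i j]; since [i] is not attained, [unbump i]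
   preserves the order of the labels in use. *)
- move=> j ltjn; have [|w wP] := lW (bump i j); first by rewrite /bump; lia.
  exists w => u v uv lej; have := lNi _ _ uv => neq.
  rewrite wP //; last by move: lej; rewrite /unbump /bump; lia.
  by rewrite /unbump /bump; lia.
Qed.

Lemma pmd_labellingP (R : realType) (G : sgraph) :
  exists l, @pmd_labelling R G (pmd R G) l.
Proof.
apply: has_pmd_labelling; rewrite /pmd; case: ex_minnP => m /asboolP hm _.
exact: hm.
Qed.

(** Labels and weights pull back along [f]; injectivity keeps distinct neighbours distinct. *)
Lemma pmd_le_inj (R : realType) (G H : sgraph) (f : G -> H) :
  injective f -> (forall u v, adj u v -> adj (f u) (f v)) -> pmd R G <= pmd R H.
Proof.
move=> injf homf; have [l [lC ltl lM lW]] := pmd_labellingP R H.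
apply: (@pmd_le_labelling R G _ (fun u v => l (f u) (f v))); split.
- by move=> u v /homf/lC.
- by move=> u v /homf/ltl.
- by move=> u v v' /homf uv /homf uv' /(lM _ _ _ uv uv')/injf.
- by move=> i /lW[w wP]; exists (w \o f) => u v /homf; apply: wP.
Qed.

Lemma chromatic_numberP (G : sgraph) :
  exists c : G -> 'I_(chromatic_number G), forall x y, adj x y -> c x != c y.
Proof.
rewrite /chromatic_number; case: ex_minnP => k /existsP[c /forallP cP] _.
by exists c => x y; move: (cP x) => /forallP/(_ y)/implyP.
Qed.

Lemma pmd_cart_prod_le (R : realType) (G1 G2 : sgraph) :
  pmd R (cart_prod G1 G2) <= pmd R G1 * chromatic_number G2 + pmd R G2.
Proof.
have [l1 [l1C ltl1 l1M l1W]] := pmd_labellingP R G1.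
have [l2 [l2C ltl2 l2M l2W]] := pmd_labellingP R G2.
have [c cP] := chromatic_numberP G2.
move: (pmd R G1) (pmd R G2) (chromatic_number G2) => p q k in ltl1 l1W ltl2 l2W c cP *.
(* Copies of edges of [G1] get the lexicographic rank of (part, colour), which is below [p * k];
   copies of edges of [G2] get the labels from [p * k] on. *)
pose l (s t : cart_prod G1 G2) : nat :=
  if s.2 == t.2 then l1 s.1 t.1 * k + c s.2 else p * k + l2 s.2 t.2.
have ltH a b y : adj a b -> l1 a b * k + c y < p * k.
  move=> /ltl1 lt; apply: (@leq_trans ((l1 a b).+1 * k)); last by rewrite leq_mul2r lt orbT.
  by rewrite mulSn addnC ltn_add2r.
have adj_neq (G : sgraph) (x y : G) : adj x y -> (x == y) = false.
  by move=> xy; apply/eqP => eqxy; rewrite eqxy adj_irr in xy.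
have lH a b y : l (a, y) (b, y) = l1 a b * k + c y by rewrite /l eqxx.
have lV a x y : adj x y -> l (a, x) (a, y) = p * k + l2 x y.
  by move=> /adj_neq neq; rewrite /l /= neq.
have adjP s t : @cart_rel G1 G2 s t ->
    (exists a x y, [/\ s = (a, x), t = (a, y) & adj x y]) \/
    (exists a b y, [/\ s = (a, y), t = (b, y) & adj a b]).
  case: s t => [a x] [b y] /orP[]/andP[] /=; last first.
    by move=> ab /eqP<-; right; exists a, b, x.
  by move=> /eqP<- xy; left; exists a, x, y.
have lt_modk (y : G2) : c y < k := ltn_ord (c y).
apply: (@pmd_le_labelling R (cart_prod G1 G2) _ l); split => /=.
- move=> s t /adjP[] [a [x [y [-> -> xy]]]].
    by rewrite !lV ?(l2C x) // adj_sym.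
  by rewrite !lH (l1C a).
- move=> s t /adjP[] [a [x [y [-> -> xy]]]].
    by rewrite lV // ltn_add2l ltl2.
  by rewrite lH; apply: leq_trans (ltH _ _ _ xy) (leq_addr _ _).
- move=> s t t' /adjP[] [a [x [y [-> -> xy]]]] /adjP[] [a' [x' [y' [[<- <-] -> xy']]]].
  + by rewrite !lV // => /addnI/(l2M _ _ _ xy xy') ->.
  + by rewrite lV // lH; have := ltH _ _ x xy'; lia.
  + by rewrite lV // lH; have := ltH _ _ y xy; lia.
  (* Both edges lie over the same vertex of [G2], so the colour terms cancel. *)
  + rewrite !lH => /addIn/eqP; rewrite eqn_pmul2r; last exact: leq_ltn_trans (lt_modk y).
    by move=> /eqP/(l1M _ _ _ xy xy') ->.
- move=> i lti; have [ltik|leki] := ltnP i (p * k); last first.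
    have [|w wP] := l2W (i - p * k); first by lia.
    (* At this stage all copies of edges of [G1] are gone, so a weight depending only on the second
       coordinate suffices. *)
    exists (w \o snd) => s t /adjP[] [a [x [y [-> -> xy]]]].
      rewrite lV // => ile /=; rewrite wP //; lia.
    by rewrite lH; have := ltH _ _ y xy; lia.
  have k_gt0 : 0 < k by case: (k) ltik => //; rewrite muln0.
  have [|w wP] := l1W (i %/ k); first by rewrite ltn_divLR.
  have i_eq := divn_eq i k; have ltmod : i %% k < k by rewrite ltn_mod.
  move: (i %/ k) (i %% k) => i0 j in wP i_eq ltmod *; subst i.
  (* A nonnegative upper bound for [w]: adding [- B] to any value of [w], or to itself, never gives
     a positive sum. *)
  pose B : R := (\sum_a `|w a|)%R.
  have B_ge0 : (0 <= B)%R by apply: sumr_ge0 => a _; apply: normr_ge0.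
  have leB a : (w a <= B)%R.
    apply: le_trans (ler_norm _) _; rewrite /B (bigD1 a) //=.
    by rewrite lerDl sumr_ge0.
  have wB a : (0 < w a - B)%R = false by rewrite subr_gt0 ltNge leB.
  have BB : (0 < - B - B)%R = false by rewrite -opprD oppr_gt0 ltNge addr_ge0.
  exists (fun s => if c s.2 == j :> nat then w s.1 else - B)%R => s t.
  move=> /adjP[] [a [x [y [-> -> xy]]]].
    rewrite lV // => _ /=; split=> [|eqi]; last by lia.
    (* Adjacent [x] and [y] cannot both have colour [j], so some endpoint weighs [- B]. *)
    case: eqP => cx; case: eqP => cy.
    + by have /eqP[] := cP _ _ xy; apply: val_inj; rewrite /= cx cy.
    + by rewrite wB.
    + by rewrite addrC wB.
    + by rewrite BB.
  rewrite lH => ile /=; have lty := lt_modk y.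
  case: eqP => cy.
    rewrite cy in ile *; rewrite wP //; last by move: ile; rewrite leq_add2r leq_pmul2r.
    split=> [->//|/addIn/eqP]; by rewrite eqn_pmul2r // => /eqP.
  (* Over another colour the label cannot be [i]: reducing modulo [k] recovers the colour. *)
  rewrite BB; split=> // eqi.
  have := congr1 (modn^~ k) eqi.
  by rewrite !modnMDl !modn_small.
Qed.

Theorem proposition2p1 (R : realType) (G1 G2 : sgraph) :
  pmd R (cart_prod G1 G2) <=
    minn (pmd R G1 * chromatic_number G2 + pmd R G2)
         (pmd R G2 * chromatic_number G1 + pmd R G1).
Proof.
rewrite leq_min pmd_cart_prod_le /=.
(* The second bound is the first one for the exchanged factors, transported along the coordinate
   swap. *)
apply: leq_trans (pmd_cart_prod_le R G2 G1).
pose swap (s : cart_prod G1 G2) : cart_prod G2 G1 := (s.2, s.1).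
apply: (@pmd_le_inj R _ _ swap) => [[a x] [b y] [-> ->] //|[a x] [b y]].
by rewrite /= /cart_rel /= orbC (andbC (adj a b)) (andbC (a == b)).
Qed.
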